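(* There is an absolute constant $C_0>0$ such that, for all integers $p\ge q\ge2$ and $s\ge2$, if $q\ge C_0\,s\log(2s)\log(ep)$, then $$p-q+s\le \mathrm{HD}_1^{(s)}(p,q)\le p-q+2s+1.$$
   Context: A set in $\mathbb{R}$ is called $s$-convex (an $s$-interval) if it is the union of at most $s$ convex sets (intervals); since only finite families are considered, one may equivalently take the intervals to be compact. For positive integers $p\ge q$, a family $\mathcal F$ of (distinct) sets with at least $p$ members satisfies the $(p,q)$-property if among every $p$ members of $\mathcal F$ some $q$ have a nonempty common intersection. A transversal (piercing set) of $\mathcal F$ is a set of points meeting every member of $\mathcal F$, and $\tau(\mathcal F)$ is the minimum size of a transversal. For $p\ge q\ge 2$, $\mathrm{HD}_1^{(s)}(p,q)$ denotes the least integer $N$ such that $\tau(\mathcal F)\le N$ for every finite family $\mathcal F$ of nonempty $s$-convex sets in $\mathbb{R}$ satisfying the $(p,q)$-property. Here $e$ is the base of the natural logarithm $\log$. *)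

(* Defs.v *)
From mathcomp Require Import all_boot all_order all_algebra finmap.
From mathcomp Require Import boolp classical_sets reals num_normedtype.

Set Implicit Arguments.
Unset Strict Implicit.
Unset Printing Implicit Defensive.

Import Order.TTheory GRing.Theory Num.Theory.

Local Open Scope ring_scope.
Local Open Scope classical_set_scope.

(* The default value 0 is returned when no natural number satisfies P. *)
Definition least (P : nat -> Prop) : nat :=
  xget 0%N [set n | P n /\ forall m, P m -> (n <= m)%N].

Lemma leastP (P : nat -> Prop) :
  (exists n, P n) -> P (least P) /\ forall m, P m -> (least P <= m)%N.
Proof.
move=> [n Pn]; apply: (@xgetPex _ 0%N [set n | P n /\ _]) => /=.
have exP : exists m, `[< P m >] by exists n; apply/asboolP.
exists (ex_minn exP); case: ex_minnP => m /asboolP Pm minm; split=> // k Pk.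
by apply: minm; apply/asboolP.
Qed.

(* The intervals may be empty, so this is a union of at most s nonempty ones;
   is_interval is order-convexity, and does not ask for closed or bounded. *)
Definition s_convex (R : realType) (s : nat) (A : set R) : Prop :=
  exists I : 'I_s -> set R,
    (forall i, is_interval (I i)) /\ A = \bigcup_(i in [set: 'I_s]) I i.

Definition pq_property (R : realType) (p q : nat) (F : {fset set R}) : Prop :=
  (p <= #|` F|)%N /\
  forall G : {fset set R}, (G `<=` F)%fset -> #|` G| = p ->
    exists H : {fset set R},
      [/\ (H `<=` G)%fset, #|` H| = q & exists x : R, forall A, A \in H -> A x].

Definition transversal (R : realType) (P : {fset R}) (F : {fset set R}) : Prop :=
  forall A, A \in F -> exists2 x, x \in P & A x.

Definition tau (R : realType) (F : {fset set R}) : nat :=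
  least (fun n => exists2 P : {fset R}, transversal P F & #|` P| = n).

(* tau is only ever used on families of nonempty sets, where it is a genuine
   minimum. *)
Lemma transversal_exists (R : realType) (F : {fset set R}) :
  (forall A, A \in F -> A !=set0) -> exists P : {fset R}, transversal P F.
Proof.
move=> F0; exists [fset xget 0 A | A in F]%fset => A AF.
exists (xget 0 A); first by apply/imfsetP; exists A.
by case: (F0 _ AF) => x Ax; exact: xgetI Ax.
Qed.

Definition HD_bound (R : realType) (s p q N : nat) : Prop :=
  forall F : {fset set R},
    (forall A, A \in F -> A !=set0 /\ s_convex s A) ->
    pq_property p q F -> (tau F <= N)%N.

(* Were there no bound N at all, HD would be 0; any positive lower bound on HD
   therefore also asserts that HD is a genuine minimum. *)
Definition HD (R : realType) (s p q : nat) : nat := least (HD_bound R s p q).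

(* Main.v *)
(* Lower bound: p - q isolated points, together with all the sets obtained from
   a long half-open interval by deleting fewer than s of its unit cells.

   Upper bound.  Put k = p - q, let load_T(x) be the number of members of T
   containing x, and let the deficit of T be |T| - max load_T.  The (p,q)-property
   says that subfamilies of maximal load < q have deficit at most k.
   (1) If fewer than about k points do not suffice to pierce the family, then by
   linear programming duality there are weights in [0,1] of total k + 1 and of
   load at most s at every point; randomized rounding followed by an alteration at
   left endpoints turns them into a subfamily with load at most D = O(s + log p)
   and deficit at least k - D.
   (2) Allow the maximal load to grow by steps of r = O(log 2s).  The maximal
   deficit lies between k - D and k, so after at most D + 1 steps it stalls: for
   some T of maximal load l, any r sets outside T have a common point in
   X = {x : load_T(x) = l}.
   (3) Sampling r sets shows that every distribution on the sets outside T has a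
   point of X of weight 3/4, so by minimax some measure on X gives mass > 1/2 to
   all these sets.  The 2s quantiles of this measure, in any shift, pierce all
   sets outside T, and the best shift also pierces at least l members of T, because
   the masses of the members of T sum to l.  Hence 2s + |T| - l <= k + 2s points
   suffice.  The loads stay below q as long as q exceeds D + (D + 1) r. *)

Require Import Defs.
From mathcomp Require Import all_boot all_order all_algebra.
From mathcomp Require Import zify ring lra.
From mathcomp Require Import boolp reals sequences exp.

Set Implicit Arguments.
Unset Strict Implicit.
Unset Printing Implicit Defensive.

Import Order.TTheory GRing.Theory Num.Theory.
Local Open Scope ring_scope.

(** * Approximate minimax for finite games *)

(** Blackwell's approachability argument: against the weights given by the current positive
    shortfalls, the reply makes the cross term of the squared distance nonpositive, so a round adds
    at most 1 per coordinate. *)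
Lemma blackwell_approach (R : realType) (I : finType) (J : eqType)
    (G : {set I}) (X : pred J) (M : J -> I -> R) (v : R) :
  0 <= v <= 1 -> (forall j i, 0 <= M j i <= 1) ->
  (forall w : I -> R, (forall i, 0 <= w i) ->
     exists2 j, X j & v * \sum_(i in G) w i <= \sum_(i in G) w i * M j i) ->
  forall t : nat, exists js : seq J,
    [/\ size js = t, all X js &
        \sum_(i in G) Num.max 0 (v * t%:R - \sum_(j <- js) M j i) ^+ 2
          <= t%:R * #|G|%:R].
Proof.
move=> /andP[v0 v1] M01 play; elim=> [|t [js [sz Xjs IH]]].
  exists [::]; split=> //; rewrite mul0r big1 // => i _.
  by rewrite big_nil mulr0 subr0 maxxx expr0n.
pose w i := Num.max 0 (v * t%:R - \sum_(j <- js) M j i).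
have w0 i : 0 <= w i by rewrite /w le_max lexx.
have [j Xj wj] := play w w0.
exists (j :: js); split; rewrite /= ?sz ?Xj //.
apply: (@le_trans _ _ (\sum_(i in G) (w i ^+ 2 + 2 * (v * w i - w i * M j i) + 1))).
  apply: ler_sum => i _; rewrite big_cons.
  have /andP[m0 m1] := M01 j i.
  have wi : v * t%:R - \sum_(j <- js) M j i <= w i by rewrite /w le_max lexx orbT.
  have := w0 i; move: (w i) wi => a ai a0.
  set b := v - M j i.
  have -> : v * t.+1%:R - (M j i + \sum_(j <- js) M j i)
          = (v * t%:R - \sum_(j <- js) M j i) + b.
    by rewrite /b -natr1; ring.
  move: (v * t%:R - _) ai => c ca.
  have b2 : b ^+ 2 <= 1 by rewrite /b; nra.
  have -> : a ^+ 2 + 2 * (v * a - a * M j i) + 1 = (a + b) ^+ 2 + (1 - b ^+ 2).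
    by rewrite /b; ring.
  rewrite maxEle; case: ifP => h.
    have : (c + b) ^+ 2 <= (a + b) ^+ 2 by rewrite ler_pXn2r ?nnegrE //; lra.
    lra.
  have := sqr_ge0 (a + b); rewrite expr0n /=; lra.
rewrite !big_split /= -mulr_sumr sumrB -mulr_sumr sumr_const -natr1.
by move: IH wj; rewrite -/w; lra.
Qed.

(** A single shortfall above e t would contribute more than e^2 t^2, which exceeds t |G| once t >
    |G| / e^2. All large t are covered, so that a convenient multiple can be chosen later. *)
Lemma approx_minimax (R : realType) (I : finType) (J : eqType)
    (G : {set I}) (X : pred J) (M : J -> I -> R) (v e : R) :
  0 <= v <= 1 -> 0 < e -> (forall j i, 0 <= M j i <= 1) ->
  (forall w : I -> R, (forall i, 0 <= w i) ->
     exists2 j, X j & v * \sum_(i in G) w i <= \sum_(i in G) w i * M j i) ->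
  exists t0 : nat, forall t, (t0 <= t)%N -> exists js : seq J,
    [/\ size js = t, all X js &
        forall i, i \in G -> (v - e) * t%:R <= \sum_(j <- js) M j i].
Proof.
move=> v01 e0 M01 play.
exists (Num.bound (#|G|%:R / e ^+ 2)) => t tb.
have [js [sz Xjs bnd]] := blackwell_approach v01 M01 play t.
exists js; split=> // i iG; rewrite leNgt; apply/negP => lt.
have e2 : 0 < e ^+ 2 by rewrite exprn_gt0.
have Gt : #|G|%:R < e ^+ 2 * t%:R.
  rewrite mulrC -ltr_pdivrMr //; apply: (lt_le_trans (archi_boundP _)).
    by rewrite divr_ge0 ?ler0n // ltW.
  by rewrite ler_nat.
move: bnd; rewrite (bigD1 i) //=.
set rest := \sum_(_ in G | _) _.
have rest0 : 0 <= rest by apply: sumr_ge0 => k _; rewrite sqr_ge0.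
set u := v * t%:R - _.
have eu : e * t%:R < u by rewrite /u; lra.
have et0 : 0 <= e * t%:R by rewrite mulr_ge0 ?ler0n // ltW.
have -> : Num.max 0 u = u by apply/max_idPr; lra.
have : (e * t%:R) ^+ 2 < u ^+ 2 by rewrite ltr_pXn2r ?nnegrE //; lra.
have : t%:R * #|G|%:R <= t%:R * (e ^+ 2 * t%:R) by rewrite ler_wpM2l // ltW.
rewrite exprMn => h1 h2 h3.
have e3 : e ^+ 2 * t%:R ^+ 2 = t%:R * (e ^+ 2 * t%:R) by ring.
lra.
Qed.

(** Each i is included independently with probability [p i], so a statistic that factors over i has
    an expectation that factors too. *)
Lemma subset_expectation (R : comPzRingType) (I : finType) (p a b : I -> R) :
  \sum_(T : {set I}) (\prod_i (if i \in T then p i else 1 - p i)) *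
                     (\prod_i (if i \in T then a i else b i))
  = \prod_i (p i * a i + (1 - p i) * b i).
Proof.
rewrite bigA_distr; apply: eq_bigr => T _; rewrite -big_split /=.
by apply: eq_bigr => i _; case: ifP.
Qed.

Lemma subset_of_card (I : finType) (A : {set I}) (m : nat) :
  (m <= #|A|)%N -> exists2 B : {set I}, B \subset A & #|B| = m.
Proof.
move=> mA; exists [set x in take m (enum A)].
  by apply/subsetP => x; rewrite inE => /mem_take; rewrite mem_enum.
rewrite cardsE; have /card_uniqP -> := take_uniq m (enum_uniq A).
by rewrite size_takel // -cardE.
Qed.

(** * Systems of unions of s intervals on a finite line *)

Section IntervalSystem.
Variables (I : finType) (n s : nat) (part : I -> 'I_s -> pred 'I_n.+1).
Hypothesis part_convex : forall A j (x y z : 'I_n.+1),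
  (x <= y <= z)%N -> part A j x -> part A j z -> part A j y.

Definition hit (A : I) (x : 'I_n.+1) : bool := [exists j, part A j x].

Definition load (T : {set I}) (x : 'I_n.+1) : nat := #|[set A in T | hit A x]|.

Definition pierces (P : {set 'I_n.+1}) : Prop :=
  forall A, exists2 x, x \in P & hit A x.

Section NatScope.
Local Open Scope nat_scope.

(** * Rounding a multiset of points to a piercing set *)

Section Residues.
Variables (xs : seq 'I_n.+1) (h : nat).
Hypotheses (xs_sorted : sorted leq (map val xs)) (h_gt0 : 0 < h).

Let m := size xs.
Let x_ (i : nat) := nth ord0 xs i.
Let idx A := [set i : 'I_m | hit A (x_ i)].
Let hits A (u : 'I_h) := [exists i in idx A, i %% h == u].

Lemma x_mono i k : i <= k < m -> x_ i <= x_ k.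
Proof.
move=> /andP[ik km].
have im : i < m by apply: leq_ltn_trans km.
have := sorted_leq_nth leq_trans leqnn 0 xs_sorted.
move=> /(_ i k); rewrite !inE !size_map -/m => /(_ im km ik).
by rewrite !(nth_map ord0).
Qed.

Lemma residue_between (i : nat) (u : 'I_h) :
  exists k, i <= k < i + h /\ k %% h = u.
Proof.
exists (i + (u + (h - i %% h)) %% h); split.
  by rewrite leq_addr ltn_add2l ltn_mod.
rewrite modnDmr addnCA.
have lt : i %% h < h by rewrite ltn_mod.
have -> : u + (i + (h - i %% h)) = (i %/ h).+1 * h + u.
  by have := divn_eq i h; lia.
by rewrite modnMDl modn_small.
Qed.

Lemma card_idx A : #|idx A| = count (hit A) xs.
Proof.
rewrite -sum1_card -sum1_count (big_nth ord0) big_mkord.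
by apply: eq_bigl => i; rewrite inE.
Qed.

(* If some residue misses A, then two indices with the same residue cannot lie
   in the same part of A, since that part would then meet all residues. *)
Lemma few_residues A :
  s * (h - #|[set u | hits A u]|) <= h * s - count (hit A) xs.
Proof.
rewrite -card_idx.
have [full|] := leqP h #|[set u | hits A u]|.
  by move: full; rewrite -subn_eq0 => /eqP ->; rewrite muln0.
move=> ltr.
have [u0 u0N] : exists u0, ~~ hits A u0.
  apply/existsP; rewrite -negb_forall; apply/negP => /forallP all.
  move: ltr; rewrite (_ : [set u | _] = setT) ?cardsT ?card_ord ?ltnn //.
  by apply/setP => u; rewrite [LHS]inE [RHS]inE; exact: all.
case: (posnP s) => [/eqP s0|s0].
  by apply: leq_trans (leq0n _); rewrite leqn0 muln_eq0 s0.
pose p (i : 'I_m) := odflt (Ordinal s0) [pick j | part A j (x_ i)].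
have pP i : i \in idx A -> part A (p i) (x_ i).
  by rewrite inE /p => /existsP[j pj]; case: pickP => //= /(_ j); rewrite pj.
pose f (i : 'I_m) : 'I_h * 'I_s := (Ordinal (ltn_pmod i h_gt0), p i).
have finj : {in idx A &, injective f}.
  suff lt_f (i k : 'I_m) : i \in idx A -> k \in idx A -> i < k -> f i <> f k.
    move=> i k iA kA fik; apply/val_inj/eqP; case: ltngtP => // lt.
      by have := lt_f _ _ iA kA lt.
    by have := lt_f _ _ kA iA lt; rewrite fik.
  move=> iA kA ik [rik pik].
  have [l [/andP[il lh] lu]] := residue_between i u0.
  have ihk : i + h <= k.
    move: ik; rewrite (divn_eq i h) (divn_eq k h) rik ltn_add2r.
    by rewrite ltn_pmul2r // addnAC leq_add2r -mulSnr => lt; rewrite leq_mul2r lt orbT.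
  have lk : l < m by apply: leq_trans (ltn_ord k); lia.
  move: u0N; rewrite negb_exists => /forallP /(_ (Ordinal lk)).
  rewrite lu eqxx andbT inE => /negP[]; apply/existsP; exists (p i).
  apply: (part_convex _ (pP _ iA)); last by rewrite pik; exact: pP kA.
  apply/andP; split; apply: x_mono; first by rewrite il.
  by rewrite ltn_ord andbT; apply: ltnW; apply: leq_trans ihk.
have sub : f @: idx A \subset setX [set u | hits A u] setT.
  apply/subsetP => _ /imsetP[i iA ->]; rewrite !inE andbT.
  by apply/existsP; exists i; rewrite iA /=.
have := subset_leq_card sub.
rewrite (card_in_imset finj) cardsX cardsT card_ord mulnBr [s * h]mulnC.
by rewrite [s * _]mulnC; apply: leq_sub2l.
Qed.

(** Average over the residues mod h: take the points at positions in one class, plus one point of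
    each set missed by that class. The classes have total size [size xs], and [few_residues] bounds
    the number of classes missing a given set. *)
Lemma residue_rounding_sorted : (forall A, exists x, hit A x) ->
  exists2 P, pierces P &
    s * h * #|P| <= s * size xs + \sum_A (h * s - count (hit A) xs).
Proof.
move=> ne.
pose cls (u : 'I_h) := [set i : 'I_m | i %% h == u].
pose unhit u := [set A | ~~ hits A u].
pose pt A := odflt ord0 [pick x | hit A x].
have ptP A : hit A (pt A).
  by rewrite /pt; case: pickP => //= no; have [x] := ne A; rewrite no.
pose P (u : 'I_h) := [set x_ (val i) | i in cls u] :|: [set pt A | A in unhit u].
have Pp u : pierces (P u).
  move=> A; have [/existsP[i /andP[iA iu]]|nh] := boolP (hits A u).
    exists (x_ i); last by rewrite inE in iA.
    by rewrite inE; apply/orP; left; apply/imsetP; exists i; rewrite ?inE.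
  exists (pt A) => //.
  by rewrite inE; apply/orP; right; apply/imsetP; exists A; rewrite ?inE.
have Pc u : #|P u| <= #|cls u| + #|unhit u|.
  by apply: (leq_trans (leq_card_setU _ _)); apply: leq_add; apply: leq_imset_card.
have sumcls : \sum_(u < h) #|cls u| = m.
  under eq_bigr => u _ do rewrite -sum1_card.
  rewrite (exchange_big_dep xpredT) //= -[RHS]card_ord -sum1_card.
  apply: eq_bigr => i _; rewrite (big_pred1 (Ordinal (ltn_pmod i h_gt0))) // => u.
  by rewrite inE -[RHS](inj_eq val_inj) /= eq_sym.
have sumun : \sum_(u < h) #|unhit u| = \sum_A (h - #|[set u | hits A u]|).
  transitivity (\sum_(u < h) \sum_(A in unhit u) 1).
    by apply: eq_bigr => u _; rewrite sum1_card.
  rewrite (exchange_big_dep xpredT) //=; apply: eq_bigr => A _.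
  have <- : #|~: [set u | hits A u]| = h - #|[set u | hits A u]|.
    by have := cardsC [set u | hits A u]; rewrite card_ord; lia.
  by rewrite -sum1_card; apply: eq_bigl => u; rewrite !inE.
pose u0 := [arg min_(u < Ordinal h_gt0) #|P u|].
have u0min u : #|P u0| <= #|P u| by rewrite /u0; case: arg_minnP => // i _; apply.
exists (P u0) => //.
have : h * #|P u0| <= \sum_(u < h) #|P u|.
  rewrite -[X in X * _](card_ord h) -sum_nat_const; exact: leq_sum.
move=> /leq_trans/(_ (leq_sum _ (fun u _ => Pc u))).
rewrite big_split /= sumcls sumun -mulnA => le.
apply: (leq_trans (leq_mul (leqnn s) le)); rewrite mulnDr leq_add2l big_distrr /=.
by apply: leq_sum => A _; exact: few_residues.
Qed.

End Residues.

Lemma residue_rounding (xs : seq 'I_n.+1) (h : nat) :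
  0 < h -> (forall A, exists x, hit A x) ->
  exists2 P, pierces P &
    s * h * #|P| <= s * size xs + \sum_A (h * s - count (hit A) xs).
Proof.
move=> h_gt0 ne; pose ys := sort (fun x y : 'I_n.+1 => x <= y) xs.
have ys_sorted : sorted leq (map val ys).
  by rewrite sorted_map; apply: sort_sorted => x y; exact: leq_total.
have [P pP cP] := residue_rounding_sorted ys_sorted h_gt0 ne.
exists P => //; move: cP; rewrite size_sort.
by under eq_bigr => A _ do rewrite (permP (permEl (perm_sort _ xs))).
Qed.

(** * Left ends of parts *)

Definition left_end (X : pred 'I_n.+1) (A : I) (j : 'I_s) : 'I_n.+1 :=
  odflt ord0
    [pick x | [&& X x, part A j x & [forall y, X y && part A j y ==> (x <= y)]]].

Lemma left_endP (X : pred 'I_n.+1) A j x : X x -> part A j x ->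
  [/\ X (left_end X A j), part A j (left_end X A j) & left_end X A j <= x].
Proof.
move=> Xx px; rewrite /left_end; case: pickP => [y /and3P[Xy py /forallP min]|no].
  by split=> //; have := min x; rewrite Xx px.
have := no [arg min_(y < x | X y && part A j y) (y : nat)].
case: arg_minnP => [|y /andP[Xy py] min]; first by rewrite Xx px.
rewrite Xy py /= => /negP[]; apply/forallP => z; apply/implyP; exact: min.
Qed.

(** Among the left ends of the parts through x, the rightmost one lies, for each set of S, between
    the left end of its part and x; convexity puts it in every set. *)
Lemma left_end_common (X : pred 'I_n.+1) (S : {set I}) x B :
  B \in S -> X x -> (forall A, A \in S -> hit A x) ->
  exists A j, [/\ A \in S, X (left_end X A j) &
                  forall C, C \in S -> hit C (left_end X A j)].
Proof.
move=> BS Xx Sx.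
have [j0 _] := existsP (Sx B BS).
pose jj A := odflt j0 [pick j | part A j x].
have jjP A : A \in S -> part A (jj A) x.
  move=> /Sx /existsP[j pj]; rewrite /jj; case: pickP => //= /(_ j).
  by rewrite pj.
have [A AS max] := arg_maxnP (fun A => left_end X A (jj A) : nat) BS.
have [XA pA Ax] := left_endP Xx (jjP A AS).
exists A, (jj A); split=> // C CS; apply/existsP; exists (jj C).
have [XC pC Cx] := left_endP Xx (jjP C CS).
apply: (part_convex _ pC (jjP C CS)); rewrite Ax andbT; exact: max.
Qed.

End NatScope.

(** * Randomized rounding with alteration *)

Section Alteration.
Variables (R : realType) (p : I -> R) (D : nat).
Hypothesis p01 : forall A, 0 <= p A <= 1.
Hypothesis p_load : forall x, \sum_(A | hit A x) p A <= s%:R.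
Hypothesis D_large : s%:R * (\sum_A p A) * expR s%:R <= 2 ^+ D.

Let weight (T : {set I}) : R := \prod_i (if i \in T then p i else 1 - p i).
Let expect (f : {set I} -> R) := \sum_T weight T * f T.

Lemma weight_ge0 T : 0 <= weight T.
Proof.
by apply: prodr_ge0 => i _; have /andP[? ?] := p01 i; case: ifP => _; lra.
Qed.

Lemma expect_cst c : expect (fun=> c) = c.
Proof.
rewrite /expect -mulr_suml.
have E := @subset_expectation R I p (fun=> 1) (fun=> 1).
rewrite [X in _ = X]big1 in E; last by move=> i _; ring.
rewrite -[RHS]mul1r -E; congr (_ * _); apply: eq_bigr => T _.
by rewrite [X in _ * X]big1 ?mulr1 // => i _; rewrite if_same.
Qed.

Lemma expect_mem A : expect (fun T => (A \in T)%:R) = p A.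
Proof.
have E := @subset_expectation R I p (fun=> 1) (fun i => (i != A)%:R).
rewrite [X in _ = X](bigD1 A) //= eqxx mulr1 mulr0 addr0 in E.
rewrite [X in _ = _ * X]big1 in E; last by move=> i iA; rewrite iA !mulr1 addrC subrK.
rewrite -[RHS]mulr1 -E; apply: eq_bigr => T _; congr (_ * _).
have [AT|AT] := boolP (A \in T).
  rewrite big1 // => i _; case: ifP => // iT; case: eqP => // iA.
  by rewrite iA AT in iT.
by rewrite (bigD1 A) //= (negbTE AT) eqxx mul0r.
Qed.

(** The factor [(i != A)] for i outside T kills the subsets that omit A. Each other set through x
    contributes 1 + p <= exp p, and these p sum to at most s. *)
Lemma expect_load A x :
  expect (fun T => (A \in T)%:R * 2 ^+ load (T :\ A) x) <= p A * expR s%:R.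
Proof.
have E := @subset_expectation R I p
  (fun i => if (i != A) && hit i x then 2 else 1) (fun i => (i != A)%:R).
rewrite [X in _ = X](bigD1 A) //= eqxx mulr1 mulr0 addr0 in E.
apply: (@le_trans _ _ (p A * \prod_(i | i != A) expR (if hit i x then p i else 0))).
  apply: (@le_trans _ _ (p A * \prod_(i | i != A)
    (p i * (if (i != A) && hit i x then 2 else 1) + (1 - p i) * (i != A)%:R))).
    rewrite -E; rewrite le_eqVlt; apply/orP; left; apply/eqP/eq_bigr => T _; congr (_ * _).
    have [AT|AT] := boolP (A \in T); last first.
      by rewrite mul0r (bigD1 A) //= (negbTE AT) eqxx mul0r.
    rewrite mul1r /load -prodr_const big_mkcond /=; apply: eq_bigr => i _.
    rewrite !inE; case: (eqVneq i A) => [->|iA] /=; first by rewrite AT.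
    by case: (i \in T) => //=; case: (hit i x).
  apply: ler_wpM2l; first by have /andP[] := p01 A.
  apply: ler_prod => i iA; have /andP[p0 p1] := p01 i; rewrite iA /=.
  case: ifP => _; last by rewrite expR0; apply/andP; split; lra.
  by have := expR_ge1Dx (p i) => ?; apply/andP; split; lra.
apply: ler_wpM2l; first by have /andP[] := p01 A.
rewrite -expR_sum ler_expR; apply: le_trans (p_load x).
rewrite [leRHS]big_mkcond /= [leRHS](bigD1 A) //= lerDr.
by case: ifP => // _; have /andP[] := p01 A.
Qed.

(* Keep the sets whose left ends are covered by few other members: by
   left_end_common the load is controlled everywhere. *)
Lemma alteration : exists2 T : {set I},
  \sum_A p A - 1 <= #|T|%:R & forall x, (load T x <= D)%N.
Proof.
pose lft A j := left_end predT A j.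
(* A Markov-type penalty: it reaches 1 once some left end of A lies in D other members of T, and by
   [D_large] its expected total over the members of T is at most 1. *)
pose bad (T : {set I}) A : R := \sum_j 2 ^+ load (T :\ A) (lft A j) / 2 ^+ D.
pose value (T : {set I}) : R := \sum_A (A \in T)%:R * (1 - bad T A).
have D0 : 0 < 2 ^+ D :> R by rewrite exprn_gt0.
have Evalue : \sum_A p A - 1 <= expect value.
  have -> : expect value = \sum_A (expect (fun T => (A \in T)%:R)
     - \sum_j expect (fun T => (A \in T)%:R * 2 ^+ load (T :\ A) (lft A j)) / 2 ^+ D).
    rewrite /expect; under eq_bigr => T _ do rewrite /value mulr_sumr.
    rewrite exchange_big /=; apply: eq_bigr => A _.
    under [X in _ = _ - X]eq_bigr => j _ do rewrite mulr_suml.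
    rewrite exchange_big /= -sumrB; apply: eq_bigr => T _.
    rewrite /bad mulrBr mulr1 mulrBr; congr (_ - _).
    by rewrite mulrA mulr_sumr; apply: eq_bigr => j _; rewrite !mulrA.
  rewrite sumrB lerB //.
    rewrite le_eqVlt; apply/orP; left; apply/eqP/eq_bigr => A _.
    by rewrite expect_mem.
  rewrite -(ler_pM2r D0) mul1r; apply: le_trans D_large.
  rewrite -mulrA [in leRHS]mulr_suml [leRHS]mulr_sumr mulr_suml.
  apply: ler_sum => A _; rewrite mulr_suml.
  apply: (@le_trans _ _ (\sum_(j < s) p A * expR s%:R)).
    apply: ler_sum => j _; rewrite divfK ?gt_eqF //; exact: expect_load.
  by rewrite sumr_const card_ord mulr_natl.
pose T := [arg max_(T > set0) value T]%O.
have Tmax U : value U <= value T.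
  by rewrite /T; case: Order.TotalTheory.arg_maxP => // V _; apply.
have vT : \sum_A p A - 1 <= value T.
  apply: le_trans Evalue _; rewrite -[leRHS]expect_cst; apply: ler_sum => U _.
  by apply: ler_wpM2l (weight_ge0 _) _ _ (Tmax U).
exists [set A in T | bad T A < 1].
  apply: le_trans vT _; rewrite -sum1_card natr_sum [leRHS]big_mkcond /=.
  apply: ler_sum => A _; rewrite inE.
  have b0 : 0 <= bad T A.
    by apply: sumr_ge0 => j _; rewrite divr_ge0 ?exprn_ge0.
  by case: (A \in T) => /=; case: ltP; lra.
move=> x; case: (posnP (load [set A in T | bad T A < 1] x)) => [-> //|].
rewrite card_gt0 => /set0Pn[B BS].
have [] := @left_end_common predT _ x _ BS isT.
  by move=> A; rewrite inE => /andP[].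
move=> A [j [AS _ common]].
move: AS; rewrite !inE => /andP[/andP[AT badA] _].
have small : (load (T :\ A) (lft A j) < D)%N.
  rewrite ltnNge; apply/negP => le.
  move: badA; rewrite ltNge => /negP[].
  rewrite /bad (bigD1 j) //= -[X in X <= _](addr0) lerD //.
    by rewrite ler_pdivlMr // mul1r ler_weXn2l // ler1n.
  by apply: sumr_ge0 => k _; rewrite divr_ge0 ?exprn_ge0.
(* The strict inequality in [small] leaves room for A itself. *)
apply: leq_trans small; rewrite -add1n -[X in (X + _)%N](cards1 A).
apply: leq_trans (leq_card_setU _ _).
apply: subset_leq_card; apply/subsetP => C CS.
have := common C CS; move: CS; rewrite !inE => /andP[/andP[-> _] _] ->.
by rewrite !andbT orbN.
Qed.

End Alteration.

(* The game behind the packing LP with weights capped by 1: the columns are the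
   sets, the rows are the points (scaled by 1/s) and one private row per set. *)
Definition capped_payoff (R : realType) (j : 'I_n.+1 + I) (A : I) : R :=
  match j with
  | inl x => (hit A x)%:R / s%:R
  | inr B => (A == B)%:R
  end.

Definition point_rows (js : seq ('I_n.+1 + I)) : seq 'I_n.+1 :=
  pmap (fun j => if j is inl x then Some x else None) js.

Lemma sum_capped_payoff (R : realType) js A :
  \sum_(j <- js) capped_payoff R j A
  = (count (hit A) (point_rows js))%:R / s%:R + (count_mem (inr A) js)%:R.
Proof.
elim: js => [|[x|B] js IH]; first by rewrite big_nil mul0r add0r.
  by rewrite big_cons IH /= natrD mulrDl addrA.
rewrite big_cons IH /= natrD addrCA; congr (_ + (_ + _)).
by rewrite -[RHS]/((B == A)%:R) eq_sym.
Qed.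

Lemma size_point_rows js :
  (size (point_rows js) + \sum_A count_mem (inr A) js = size js)%N.
Proof.
elim: js => [|[x|B] js IH] /=; first by rewrite big1.
  by rewrite -IH addSn.
rewrite -IH big_split /= addnCA -[RHS]add1n; congr (_ + _)%N.
rewrite (bigD1 B) //= big1 ?addn0 => [|A AB].
  by rewrite -[LHS]/(nat_of_bool (B == B)) eqxx.
by rewrite -[LHS]/(nat_of_bool (B == A)) eq_sym (negbTE AB).
Qed.

(** Minimax turns the replies into a multiset of rows good for all sets at once. Its point rows are
    rounded by residues; each private row of A pays for s missing hits of A, so the rounding costs
    no more than all rows together. *)
Lemma piercing_of_play (R : realType) (K : nat) : (0 < s)%N -> (0 < K)%N ->
  (forall A, exists x, hit A x) ->
  (forall w : I -> R, (forall A, 0 <= w A) -> exists j,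
     K%:R^-1 * \sum_A w A <= \sum_A w A * capped_payoff R j A) ->
  exists2 P, pierces P & (#|P| <= K)%N.
Proof.
move=> s0 K0 ne play.
have sR : 0 < s%:R :> R by rewrite ltr0n.
have KR : 0 < K%:R :> R by rewrite ltr0n.
(* With 2K(K+1)a rows, (1/K - e) times their number is exactly h = (2K+1)a; as h(K+1) exceeds
   2K(K+1)a, the piercing set has at most K points. *)
pose e : R := (2 * K%:R * (K%:R + 1))^-1.
have e0 : 0 < e by rewrite invr_gt0 !mulr_gt0 // ltr_wpDr.
have v01 : 0 <= (K%:R^-1 : R) <= 1.
  by rewrite invr_ge0 ler0n invf_le1 // ler1n.
have M01 j A : 0 <= capped_payoff R j A <= 1.
  case: j => [x|B] /=; last by case: eqP => _; rewrite ?lexx ?ler01.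
  case: (hit A x); rewrite ?mul0r ?lexx ?ler01 // mul1r invr_ge0 ler0n.
  by rewrite invf_le1 // ler1n.
have [|t0 H] := @approx_minimax R I _ [set: I] predT (capped_payoff R) _ e v01 e0 M01.
  move=> w w0; have [j jw] := play w w0; exists j => //.
  have inT (f : I -> R) : \sum_(A in [set: I]) f A = \sum_A f A.
    by apply: eq_bigl => A; rewrite inE.
  by rewrite !inT.
pose a := t0.+1.
have a0 : 0 < a%:R :> R by rewrite ltr0n.
have [|js [szjs _ jsP]] := H (2 * K * K.+1 * a)%N.
  by rewrite -[leqLHS]mul1n leq_mul // !muln_gt0 K0.
pose h := ((2 * K).+1 * a)%N.
have h0 : (0 < h)%N by rewrite /h /a; lia.
pose xs := point_rows js.
have [P pP cP] := residue_rounding xs h0 ne.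
exists P => //.
have cA A : (h * s - count (hit A) xs <= s * count_mem (inr A) js)%N.
  rewrite leq_subLR -(ler_nat R).
  have := jsP A (in_setT _); rewrite sum_capped_payoff.
  have -> : (K%:R^-1 - e) * (2 * K * K.+1 * a)%:R = h%:R.
    have -> : h%:R = (2 * K%:R + 1) * a%:R :> R by rewrite /h natrM mulrSr natrM.
    rewrite /e !natrM -[K.+1%:R]natr1.
    by field; apply/andP; split; apply: lt0r_neq0 => //; apply: addr_gt0.
  rewrite -/xs => le; rewrite natrM natrD natrM.
  have -> : (count (hit A) xs)%:R = (count (hit A) xs)%:R / s%:R * s%:R :> R.
    by rewrite divfK // gt_eqF.
  rewrite [X in _ + X]mulrC -mulrDl ler_pM2r //.
have : (s * h * #|P| <= s * size js)%N.
  apply: leq_trans cP _; rewrite -size_point_rows mulnDr leq_add2l.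
  by rewrite big_distrr /=; apply: leq_sum => A _; exact: cA.
rewrite -mulnA leq_pmul2l // szjs => le; rewrite leqNgt; apply/negP => KP.
have := leq_trans (leq_mul (leqnn h) KP) le; rewrite leqNgt => /negP[].
by rewrite /h mulnAC ltn_pmul2r // ltn_pmul2r.
Qed.

(** If some weighting defeats every row, rescale it to total K: the private rows say that weights
    are at most 1, the point rows that loads are at most s. The alteration then loses at most 1. *)
Lemma sparse_subfamily (R : realType) (K D : nat) : (0 < s)%N -> (0 < K)%N ->
  (forall A, exists x, hit A x) -> s%:R * K%:R * expR s%:R <= 2 ^+ D :> R ->
  (exists2 P, pierces P & (#|P| <= K)%N) \/
  (exists2 T : {set I}, (K <= #|T|.+1)%N & forall x, (load T x <= D)%N).
Proof.
move=> s0 K0 ne Dlarge.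
have sR : 0 < s%:R :> R by rewrite ltr0n.
have KR : 0 < K%:R :> R by rewrite ltr0n.
have [play|noplay] := pselect (forall w : I -> R, (forall A, 0 <= w A) ->
  exists j, K%:R^-1 * \sum_A w A <= \sum_A w A * capped_payoff R j A).
  by left; exact: piercing_of_play play.
right.
have [w [w0 wlt]] : exists w : I -> R, (forall A, 0 <= w A) /\
  forall j, \sum_A w A * capped_payoff R j A < K%:R^-1 * \sum_A w A.
  apply: contrapT => no; apply: noplay => w w0.
  apply: contrapT => nj; apply: no; exists w; split=> // j.
  by rewrite ltNge; apply/negP => le; apply: nj; exists j.
set W := \sum_A w A in wlt.
have W0 : 0 < W.
  rewrite -(pmulr_rgt0 _ (_ : 0 < K%:R^-1)) ?invr_gt0 //.
  apply: le_lt_trans (wlt (inl ord0)); apply: sumr_ge0 => A _ /=.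
  by rewrite mulr_ge0 // divr_ge0.
pose p A := K%:R * w A / W.
have pE A : p A = w A * (K%:R / W) by rewrite /p; ring.
have KW : 0 < K%:R / W by rewrite divr_gt0.
have sumKW : K%:R^-1 * W * (K%:R / W) = 1.
  by field; rewrite !gt_eqF.
have p01 A : 0 <= p A <= 1.
  rewrite pE mulr_ge0 //=; last exact: ltW.
  have := wlt (inr A); rewrite (bigD1 A) //= eqxx mulr1 big1 => [|B BA].
    by rewrite addr0 -(ltr_pM2r KW) sumKW => /ltW.
  by rewrite (negbTE BA) mulr0.
have sum_p : \sum_A p A = K%:R.
  rewrite (eq_bigr (fun A => w A * (K%:R / W))) => [|A _]; last exact: pE.
  by rewrite -mulr_suml mulrC divfK // gt_eqF.
have p_load x : \sum_(A | hit A x) p A <= s%:R.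
  have := wlt (inl x); rewrite -(ltr_pM2r KW) sumKW => /ltW le.
  rewrite -[leRHS]mul1r -ler_pdivrMr //; apply: le_trans le.
  rewrite big_mkcond /= !mulr_suml; apply: ler_sum => A _.
  case: (hit A x) => /=; last by rewrite !mul0r mulr0 mul0r.
  by rewrite pE mul1r mulrAC.
have Dl : s%:R * (\sum_A p A) * expR s%:R <= 2 ^+ D by rewrite sum_p.
have [T KT loadT] := alteration p01 p_load Dl.
by exists T => //; rewrite -(ler_nat R) -natr1; move: KT; rewrite sum_p; lra.
Qed.

(* Draw r.+1 sets independently: they have a common point in X, which may be
   taken to be a left end of one of them, and this left end then lies in the
   other r sets. *)
Lemma heavy_point (R : realType) (G : {set I}) (X : pred 'I_n.+1) (r : nat)
    (lam : R) (x0 : 'I_n.+1) : X x0 ->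
  r.+1%:R * s%:R * lam ^+ r < 1 ->
  (forall f : {ffun 'I_r.+1 -> I}, (forall i, f i \in G) ->
     exists2 x, X x & forall i, hit (f i) x) ->
  forall w : I -> R, (forall A, 0 <= w A) ->
  exists2 x, X x & lam * \sum_(A in G) w A <= \sum_(A in G) w A * (hit A x)%:R.
Proof.
move=> Xx0 lam_small common w w0; apply: contrapT => no.
set W := \sum_(A in G) w A in no.
have light x : X x -> \sum_(A in G) w A * (hit A x)%:R < lam * W.
  by move=> Xx; rewrite ltNge; apply/negP => le; apply: no; exists x.
have W0 : 0 < W.
  rewrite lt_def sumr_ge0 ?andbT //; apply/eqP => W0.
  have := light _ Xx0; rewrite W0 mulr0 ltNge sumr_ge0 // => A _.
  by rewrite mulr_ge0.
pose a A := (A \in G)%:R * w A / W.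
have a0 A : 0 <= a A by rewrite !mulr_ge0 // invr_ge0 ltW.
have sum_a : \sum_A a A = 1.
  rewrite -mulr_suml -[RHS](divff (lt0r_neq0 W0)); congr (_ / _).
  rewrite [RHS]big_mkcond; apply: eq_bigr => A _.
  by case: (A \in G); rewrite ?mul1r ?mul0r.
pose m x := \sum_A a A * (hit A x)%:R.
have m_light x : X x -> m x <= lam.
  move=> /light /ltW; rewrite -ler_pdivrMr // => le; apply: le_trans le.
  rewrite mulr_suml [leRHS]big_mkcond; apply: ler_sum => A _ /=.
  by rewrite /a; case: ifP => _; rewrite ?mul0r // mul1r mulrAC.
have m_ge0 x : 0 <= m x by apply: sumr_ge0 => A _; rewrite mulr_ge0.
pose y j A := left_end X A j.
(* The probability of the draws times the indicator that draw i0 is A, that its left end in part j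
   lies in X, and that all other draws contain this point; written as a product over draws. *)
pose F (i0 : 'I_r.+1) j A (i : 'I_r.+1) B : R :=
  if i == i0 then (B == A)%:R * (a B * (X (y j A))%:R)
  else a B * (hit B (y j A))%:R.
have F0 i0 j A i B : 0 <= F i0 j A i B.
  rewrite /F; case: ifP => _; last exact: mulr_ge0.
  by apply: mulr_ge0 => //; exact: mulr_ge0.
have prod_F i0 j A : \prod_i \sum_B F i0 j A i B <= a A * lam ^+ r.
  rewrite (bigD1 i0) //= /F eqxx (bigD1 A) //= eqxx mul1r big1 ?addr0; last first.
    by move=> B /negbTE ->; rewrite mul0r.
  have [Xy|_] := boolP (X (y j A)); last first.
    rewrite mulr0 mul0r mulr_ge0 // exprn_ge0 //.
    exact: le_trans (m_ge0 x0) (m_light _ Xx0).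
  rewrite mulr1 ler_wpM2l //.
  apply: (@le_trans _ _ (\prod_(i < r.+1 | i != i0) lam)).
    apply: ler_prod => i /negbTE ->; rewrite sumr_ge0 /=; last first.
      by move=> B _; rewrite mulr_ge0.
    exact: m_light.
  by rewrite prodr_const cardC1 card_ord.
have dominate (f : {ffun 'I_r.+1 -> I}) :
    \prod_i a (f i) <= \sum_i0 \sum_j \sum_A \prod_i F i0 j A i (f i).
  have rhs0 : 0 <= \sum_i0 \sum_j \sum_A \prod_i F i0 j A i (f i).
    by do 3![apply: sumr_ge0 => ? _]; apply: prodr_ge0.
  have [/forallP fG|/forallPn[i fiG]] := boolP [forall i, f i \in G]; last first.
    by rewrite (bigD1 i) //= /a (negbTE fiG) !mul0r.
  have [x Xx fx] := common f fG.
  have [|A [j [/imsetP[i0 _ ->] Xy fy]]] :=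
    @left_end_common X (f @: setT) x (f ord0) (imset_f f (in_setT _)) Xx.
    by move=> _ /imsetP[i _ ->].
  rewrite [leRHS](bigD1 i0) //= (bigD1 j) //= (bigD1 (f i0)) //=.
  have -> : \prod_i F i0 j (f i0) i (f i) = \prod_i a (f i).
    apply: eq_bigr => i _; rewrite /F; case: eqP => [->|_].
      by rewrite eqxx mul1r /y Xy mulr1.
    by rewrite /y fy ?mulr1 // imset_f.
  rewrite -!addrA lerDl !addr_ge0 //; do ?[apply: sumr_ge0 => ? _]; exact: prodr_ge0.
(* Union bound over i0 and j: the total probability 1 would be at most (r+1) s lam^r. *)
have : \prod_(i < r.+1) \sum_A a A <= r.+1%:R * s%:R * lam ^+ r.
  rewrite bigA_distr_bigA /=.
  apply: le_trans (ler_sum _ (fun f _ => dominate f)) _.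
  rewrite exchange_big /=.
  apply: (@le_trans _ _ (\sum_(i0 < r.+1) \sum_(j < s) lam ^+ r)).
    apply: ler_sum => i0 _; rewrite exchange_big /=; apply: ler_sum => j _.
    have -> : lam ^+ r = \sum_A a A * lam ^+ r by rewrite -mulr_suml sum_a mul1r.
    rewrite exchange_big /=.
    apply: ler_sum => A _; apply: le_trans (prod_F i0 j A).
    by rewrite bigA_distr_bigA.
  by rewrite !sumr_const !card_ord -mulrA !mulr_natl.
by rewrite [leLHS]big1 // leNgt lam_small.
Qed.

Lemma sum_count (T : {set I}) (xs : seq 'I_n.+1) :
  (\sum_(A in T) count (hit A) xs = \sum_(x <- xs) load T x)%N.
Proof.
elim: xs => [|x xs IH]; first by rewrite big_nil big1.
rewrite big_cons -IH /= big_split /=; congr (_ + _)%N.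
rewrite /load -sum1_card [RHS]big_mkcond [LHS]big_mkcond /=.
by apply: eq_bigr => A _; rewrite inE; case: (A \in T); case: (hit A x).
Qed.

(** Minimax at 3/4 - 1/4 = 1/2 gives 2sh points of X hitting each set outside T at least sh times,
    so rounding with modulus h charges only the members of T. *)
Lemma tight_cover (R : realType) (T : {set I}) (l r : nat) : (0 < s)%N ->
  r.+1%:R * s%:R * (3 / 4) ^+ r < 1 :> R ->
  (forall A, exists x, hit A x) ->
  (forall G : {set I}, G \subset ~: T -> (#|G| <= r.+1)%N ->
     exists2 x, load T x = l & forall A, A \in G -> hit A x) ->
  exists2 P, pierces P & (#|P| <= 2 * s + (#|T| - l))%N.
Proof.
move=> s0 small ne common; pose X x := load T x == l.
have [x0 /eqP Xx0 _] := common set0 (sub0set _) (leq_trans (eq_leq (cards0 _)) isT).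
have [||||t0 H] := @approx_minimax R I _ (~: T) X (fun x A => (hit A x)%:R)
                    (3 / 4) (1 / 4).
- by lra.
- by lra.
- by move=> x A; case: (hit A x); rewrite ?lexx ?ler01.
- apply: (heavy_point Xx0 small) => f fT.
  have [||x /eqP Xx xf] := common (f @: setT).
  + by apply/subsetP => _ /imsetP[i _ ->].
  + by apply: leq_trans (leq_imset_card _ _) _; rewrite cardsT card_ord.
  by exists x => // i; apply: xf; apply: imset_f.
pose h := t0.+1.
have [|js [szjs Xjs jsP]] := H (2 * s * h)%N.
  by rewrite -[leqLHS]mul1n leq_mul // muln_gt0.
have [P pP cP] := residue_rounding js (ltn0Sn t0) ne.
exists P => //.
have outT A : A \notin T -> (h * s - count (hit A) js = 0)%N.
  move=> AT; apply/eqP; rewrite subn_eq0 -(ler_nat R) -sum1_count natr_sum.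
  have := jsP A; rewrite inE AT => /(_ isT) le.
  rewrite big_mkcond /=; apply: le_trans (le_trans _ le) _.
    by rewrite !natrM; lra.
  by apply: ler_sum => x _; case: (hit A x).
have loadT : (\sum_(A in T) count (hit A) js = 2 * s * h * l)%N.
  rewrite sum_count -szjs -sum1_size big_distrl /=.
  rewrite big_seq [RHS]big_seq; apply: eq_bigr => x /(allP Xjs)/eqP ->.
  by rewrite mul1n.
have inT : (\sum_(A in T) (h * s - count (hit A) js) <= h * s * (#|T| - l))%N.
  (* A count c <= 2hs satisfies 2 max(0, hs - c) + c <= 2hs; the counts over T sum to 2shl because
     every chosen point has load l. *)
  have le : (\sum_(A in T) (2 * (h * s - count (hit A) js) + count (hit A) js)
            <= \sum_(A in T) 2 * (h * s))%N.
    apply: leq_sum => A _; have := count_size (hit A) js; rewrite szjs; nia.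
  move: le; rewrite big_split /= -big_distrr /= loadT sum_nat_const.
  by move=> le; rewrite mulnBr leq_subRL; nia.
have : (s * h * #|P| <= s * h * (2 * s + (#|T| - l)))%N.
  apply: leq_trans cP _; rewrite szjs mulnDr.
  rewrite [X in (_ + X <= _)%N](bigID (mem T)) /= [X in (_ + (_ + X) <= _)%N]big1 //.
  by rewrite addn0; apply: leq_add; [nia | rewrite [(s * h)%N]mulnC].
by rewrite leq_pmul2l // muln_gt0 s0.
Qed.

(** * Deficits and the plateau argument *)

Local Open Scope nat_scope.

Definition maxload (T : {set I}) : nat := \max_x load T x.

Definition deficit (T : {set I}) : nat := #|T| - maxload T.

Definition max_deficit (l : nat) : nat := \max_(T | maxload T <= l) deficit T.

Lemma load_le_maxload T x : load T x <= maxload T.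
Proof. exact: leq_bigmax. Qed.

Lemma load_le_card (T : {set I}) x : load T x <= #|T|.
Proof. by apply/subset_leq_card/subsetP => A; rewrite inE => /andP[]. Qed.

Lemma maxload_le_card (T : {set I}) : maxload T <= #|T|.
Proof. by apply/bigmax_leqP => x _; exact: load_le_card. Qed.

Lemma load_setU (T G : {set I}) x : load (T :|: G) x <= load T x + load G x.
Proof.
apply: leq_trans (leq_card_setU _ _); apply/subset_leq_card/subsetP => A.
by rewrite !inE => /andP[/orP[]-> ->]; rewrite ?orbT.
Qed.

Lemma card_load (T : {set I}) x :
  load T x + #|[set A in T | ~~ hit A x]| = #|T|.
Proof.
rewrite -(cardsID [set A | hit A x] T); congr (_ + _); apply: eq_card => A;
  by rewrite !inE // andbC.
Qed.

(** A subfamily of p members of T would have a point of load q. So |T| < p; pad T to p sets: some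
    point is missed by at most p - q of them, hence by at most p - q members of T. *)
Lemma deficit_bound (p q : nat) (T : {set I}) : q <= p -> p <= #|I| ->
  (forall S : {set I}, #|S| = p -> exists x, q <= load S x) ->
  maxload T < q -> deficit T <= p - q.
Proof.
move=> qp pI pq Tq; rewrite /deficit.
have [pT|Tp] := leqP p #|T|.
  have [S ST Sp] := subset_of_card pT.
  have [x qx] := pq S Sp; have := load_le_maxload T x.
  have : load S x <= load T x.
    apply/subset_leq_card/subsetP => A; rewrite !inE => /andP[AS ->].
    by rewrite (subsetP ST).
  lia.
have [|U UT Up] := @subset_of_card I (~: T) (p - #|T|).
  by have := cardsC T; lia.
have dis : [disjoint T & U] by rewrite disjoint_sym disjoints_subset.
have Sp : #|T :|: U| = p.
  by rewrite cardsU disjoint_setI0 // cards0 Up; lia.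
have [x qx] := pq _ Sp; have := load_le_maxload T x.
have := card_load T x; have := card_load (T :|: U) x.
have : #|[set A in T | ~~ hit A x]| <= #|[set A in T :|: U | ~~ hit A x]|.
  by apply/subset_leq_card/subsetP => A; rewrite !inE => /andP[-> ->].
lia.
Qed.

Lemma deficit_le_max T l : maxload T <= l -> deficit T <= max_deficit l.
Proof. by move=> Tl; exact: (leq_bigmax_cond _ Tl). Qed.

Lemma max_deficit_attained l :
  exists2 T, maxload T <= l & deficit T = max_deficit l.
Proof.
have [|T Tl eqT] := @eq_bigmax_cond _ [pred T | maxload T <= l] deficit.
  apply/card_gt0P; exists set0; rewrite inE.
  by apply: leq_trans (maxload_le_card _) _; rewrite cards0.
by exists T => //; rewrite -eqT; apply: eq_bigl => U; rewrite inE.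
Qed.

(* A family T whose deficit cannot be improved by adding r sets: its deficit
   stays put only if the added sets meet at a point where T has maximal load. *)
Lemma plateau_common (l r : nat) (T G : {set I}) :
  maxload T <= l -> max_deficit (l + r) <= deficit T ->
  G \subset ~: T -> #|G| <= r ->
  exists2 x, load T x = maxload T & forall A, A \in G -> hit A x.
Proof.
move=> Tl plateau GT Gr.
have dis : [disjoint T & G] by rewrite disjoint_sym disjoints_subset.
have cTG : #|T :|: G| = #|T| + #|G| by rewrite cardsU disjoint_setI0 // cards0 subn0.
have [|x xmax] := @bigop.eq_bigmax _ (load (T :|: G)); first by rewrite card_ord.
have le := load_setU T G x.
have lT := load_le_maxload T x; have lG := load_le_card G x.
have mx : maxload (T :|: G) = load (T :|: G) x := xmax.
have ml : maxload (T :|: G) <= l + r by rewrite mx; lia.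
have := leq_trans (deficit_le_max ml) plateau.
have := maxload_le_card T; rewrite /deficit cTG mx => Tc dd.
have eqG : load G x = #|G| by lia.
exists x; first by lia.
move=> A AG; have /eqP := eqG.
rewrite eqn_leq => /andP[_]; rewrite /load => le2.
have sub : [set B in G | hit B x] \subset G.
  by apply/subsetP => B; rewrite inE => /andP[].
have /eqP eq : [set B in G | hit B x] == G by rewrite eqEcard sub.
by move: AG; rewrite -{1}eq inE => /andP[].
Qed.

(** Otherwise each of D + 1 steps gains at least 1, climbing from at least k - D to beyond k. *)
Lemma exists_plateau (D k r : nat) :
  k - D <= max_deficit D -> max_deficit (D + D.+1 * r) <= k ->
  exists2 i, i <= D & max_deficit (D + i * r + r) <= max_deficit (D + i * r).
Proof.
move=> low high; apply: contrapT => no.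
have grow i : i <= D.+1 -> max_deficit D + i <= max_deficit (D + i * r).
  elim: i => [|i IH] iD; first by rewrite mul0n !addn0.
  have lt : max_deficit (D + i * r) < max_deficit (D + i * r + r).
    by rewrite ltnNge; apply/negP => le; apply: no; exists i.
  by rewrite mulSnr addnA addnS; apply: leq_trans lt; apply/IH/ltnW.
by have := grow _ (leqnn _); lia.
Qed.

Theorem piercing_bound (R : realType) (p q D r : nat) : 0 < s -> q <= p ->
  p <= #|I| ->
  (forall A, exists x, hit A x) ->
  (forall S : {set I}, #|S| = p -> exists x, q <= load S x) ->
  (s%:R * (p - q).+1%:R * expR s%:R <= 2 ^+ D :> R)%R ->
  (r.+1%:R * s%:R * (3 / 4) ^+ r < 1 :> R)%R ->
  D + D.+1 * r.+1 < q ->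
  exists2 P, pierces P & #|P| <= p - q + 2 * s.
Proof.
move=> s0 qp pI ne pq Dlarge rlarge qlarge.
have [[P pP cP]|[T0 kT0 loadT0]] :=
  sparse_subfamily s0 (ltn0Sn (p - q)) ne Dlarge.
  by exists P => //; lia.
have dT0 : maxload T0 <= D by apply/bigmax_leqP => x _; exact: loadT0.
(* Here K = p - q + 1, so T0 has at least p - q members. *)
have low : (p - q) - D <= max_deficit D.
  by apply: leq_trans (deficit_le_max dT0); rewrite /deficit; lia.
have high l : l < q -> max_deficit l <= p - q.
  move=> lq; apply/bigmax_leqP => T Tl.
  by apply: (deficit_bound qp pI pq); apply: leq_ltn_trans lq.
(* Steps have length r + 1, the number of sets for which [tight_cover] wants a common point. *)
have [i iD plateau] := exists_plateau low (high _ qlarge).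
have [T Tl dT] := max_deficit_attained (D + i * r.+1).
have [|P pP cP] := @tight_cover R T (maxload T) r s0 rlarge ne.
  by move=> G GT Gr; apply: (plateau_common Tl) Gr => //; rewrite dT.
exists P => //; apply: leq_trans cP _.
rewrite addnC leq_add2r -/(deficit T) dT; apply: high.
by apply: leq_ltn_trans qlarge; rewrite leq_add2l leq_mul2r orbC ltnW.
Qed.

End IntervalSystem.

(** * Choice of the parameters *)

Lemma ln2_ge_half (R : realType) : 1 / 2 <= ln 2 :> R.
Proof.
have -> : 2 = (1 + (- (1 / 2)))^-1 :> R by field.
rewrite lnV ?posrE; last by lra.
have := @le_ln1Dx R (- (1 / 2)); lra.
Qed.

Lemma exp_beats_linear (m : nat) : (2 <= m)%N ->
  ((8 * m).+1 * 2 ^ m < 2 * 9 ^ m)%N.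
Proof.
elim: m => // m IH; rewrite leq_eqVlt => /orP[/eqP <- //|m2].
have := IH m2; rewrite !expnS; have : (0 < 2 ^ m)%N by rewrite expn_gt0.
nia.
Qed.

Lemma ln_double_ge1 (R : realType) (s : nat) : (2 <= s)%N -> 1 <= ln (2 * s%:R) :> R.
Proof.
move=> s2; have sR : 2 <= s%:R :> R by rewrite ler_nat.
rewrite lnM ?posrE //; last by lra.
have := ln2_ge_half R; have : ln 2 <= ln s%:R :> R by rewrite ler_ln ?posrE //; lra.
lra.
Qed.

Lemma sample_size (R : realType) (s : nat) : (2 <= s)%N ->
  exists2 r : nat, r.+1%:R * s%:R * (3 / 4) ^+ r < 1 :> R &
                   r.+1%:R <= 25 * ln (2 * s%:R) :> R.
Proof.
move=> s2; set m := up_log 2 (2 * s).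
have sR : 2 <= s%:R :> R by rewrite ler_nat.
have m2 : (2 <= m)%N.
  have -> : 2%N = up_log 2 (2 ^ 2) by rewrite up_expnK.
  by rewrite leq_up_log //; lia.
have sm : (2 * s <= 2 ^ m)%N by apply: up_logP.
(* Since (3/4)^8 <= 1/9, the power is at most 9^-m, which beats 8m + 1 and 2s <= 2^m together. *)
exists (8 * m)%N.
  rewrite exprM.
  have q8 : (3 / 4) ^+ 8 <= 9^-1 :> R by lra.
  apply: (@le_lt_trans _ _ ((8 * m).+1%:R * s%:R * 9^-1 ^+ m)).
    apply: ler_wpM2l; first by rewrite mulr_ge0 // ler0n.
    apply: lerXn2r => //; rewrite nnegrE ?exprn_ge0 ?invr_ge0 ?divr_ge0 //.
  rewrite exprVn ltr_pdivrMr ?exprn_gt0 // mul1r -natrX -natrM ltr_nat.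
  rewrite -(ltn_pmul2l (isT : 0 < 2)%N); apply: leq_ltn_trans (exp_beats_linear m2).
  by rewrite mulnCA leq_mul2l sm orbT.
have ln4 : 1 <= ln (2 * s%:R) :> R by exact: ln_double_ge1.
have m1 : m.-1%:R * ln 2 <= ln (2 * s%:R) :> R.
  rewrite mulr_natl -lnXn // ler_ln ?posrE ?exprn_gt0 //; last by lra.
  by rewrite -natrX -natrM ler_nat ltnW // up_log_gtn //; lia.
have mE : m%:R = m.-1%:R + 1 :> R by rewrite natr1 prednK // ltnW.
have -> : (8 * m).+1%:R = 8 * m%:R + 1 :> R by rewrite mulrSr natrM.
(* With L = ln(2s) >= 1: m - 1 <= 2L, so 8m + 1 <= 16L + 9 <= 25L. *)
have := ln2_ge_half R; rewrite mE.
have := ler0n R m.-1; nra.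
Qed.

Lemma sparsity (R : realType) (p q s : nat) : (0 < q <= p)%N -> (1 <= s)%N ->
  exists2 D : nat, s%:R * (p - q).+1%:R * expR s%:R <= 2 ^+ D :> R &
                   D%:R <= 5 * s%:R * ln (expR 1 * p%:R) :> R.
Proof.
move=> /andP[q0 qp] s1.
have p1 : 1 <= p%:R :> R by rewrite ler1n (leq_trans q0).
have sR : 1 <= s%:R :> R by rewrite ler1n.
have lnp : 0 <= ln p%:R :> R by rewrite ln_ge0.
have -> : ln (expR 1 * p%:R) = 1 + ln p%:R :> R.
  by rewrite lnM ?posrE ?expR_gt0 ?expRK //; lra.
(* The left side is at most exp(2s + ln p) = exp(x/2), and 2^D >= exp(D/2) because ln 2 >= 1/2. *)
pose x : R := 4 * s%:R + 2 * ln p%:R.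
have x0 : 0 <= x by rewrite /x; lra.
have /andP[Dx xD] := Num.Theory.truncn_itv x0.
exists (Num.truncn x).+1; last by rewrite -natr1; move: Dx; rewrite /x; nra.
have -> : 2 = expR (ln 2) :> R by rewrite lnK // posrE.
rewrite -expRM_natl.
apply: (@le_trans _ _ (expR (s%:R + ln p%:R + s%:R))).
  rewrite !expRD ler_wpM2r ?expR_ge0 //; apply: ler_pM => //.
    by apply: le_trans (expR_ge1Dx _); rewrite lerDr.
  by rewrite lnK ?posrE ?ler_nat; [lia | lra].
rewrite ler_expR; have := ln2_ge_half R; move: xD; rewrite /x; nra.
Qed.

Lemma parameters (R : realType) (p q s : nat) :
  (2 <= q)%N -> (q <= p)%N -> (2 <= s)%N ->
  200 * s%:R * ln (2 * s%:R) * ln (expR 1 * p%:R) <= q%:R :> R ->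
  exists D r : nat,
    [/\ s%:R * (p - q).+1%:R * expR s%:R <= 2 ^+ D :> R,
        r.+1%:R * s%:R * (3 / 4) ^+ r < 1 :> R & (D + D.+1 * r.+1 < q)%N].
Proof.
move=> q2 qp s2 qlarge.
have [D D1 D2] := @sparsity R p q s (introT andP (conj (ltnW q2) qp)) (ltnW s2).
have [r r1 r2] := @sample_size R s s2.
exists D, r; split=> //; rewrite -(ltr_nat R); apply: lt_le_trans qlarge.
have sR : 2 <= s%:R :> R by rewrite ler_nat.
have L1 : 1 <= ln (2 * s%:R) :> R by exact: ln_double_ge1.
have P1 : 1 <= ln (expR 1 * p%:R) :> R.
  have p1 : 1 <= p%:R :> R by rewrite ler1n (leq_trans _ qp) // ltnW.
  rewrite lnM ?posrE ?expR_gt0 ?expRK //; last by lra.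
  by rewrite lerDl ln_ge0.
move: D2 r2; rewrite natrD natrM -[D.+1%:R]natr1.
move: (ln (2 * s%:R)) (ln (expR 1 * p%:R)) L1 P1 => L P L1 P1.
have := ler0n R D; move: (D%:R) (r.+1%:R) (s%:R) sR (ler0n R r.+1).
move=> d r' s' s'2 r'0 d0 dle r'le.
have sP : 1 <= s' * P by nra.
(* D + 1 <= 6sP and r + 2 <= 26L, whence 6 * 26 = 156, below the constant 200. *)
have dP : d + 1 <= 6 * (s' * P) by lra.
have h : (d + 1) * (r' + 1) <= 6 * (s' * P) * (26 * L).
  by apply: ler_pM; lra.
have : 1 <= s' * P * L by nra.
have -> : 200 * s' * L * P = 200 * (s' * P * L) by ring.
have -> : d + (d + 1) * r' = (d + 1) * (r' + 1) - 1 by ring.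
lra.
Qed.

(** * Sets of reals: the upper bound *)

From mathcomp Require Import finmap classical_sets num_normedtype.

Lemma tau_le (R : realType) (P : {fset R}) (F : {fset set R}) (m : nat) :
  Defs.transversal P F -> (#|` P| <= m)%N -> (tau F <= m)%N.
Proof.
move=> tP Pm; apply: leq_trans Pm.
have ex : exists n, exists2 Q : {fset R}, Defs.transversal Q F & #|` Q| = n.
  by exists #|` P|, P.
by apply: (leastP ex).2; exists P.
Qed.

(** The line is replaced by a sorted list with one common point for each subfamily that has one:
    intervals stay convex in the index, and common intersections survive. *)
Lemma HD_bound_upper (R : realType) (s p q D r : nat) :
  (0 < s)%N -> (q <= p)%N ->
  s%:R * (p - q).+1%:R * expR s%:R <= 2 ^+ D :> R ->
  r.+1%:R * s%:R * (3 / 4) ^+ r < 1 :> R ->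
  (D + D.+1 * r.+1 < q)%N ->
  HD_bound R s p q (p - q + 2 * s).
Proof.
move=> s0 qp Dlarge rlarge qlarge F Fsconv [pF pq].
have exJ (A : F) : exists JA : 'I_s -> set R, (forall j, is_interval (JA j)) /\
    val A = (\bigcup_(j in [set: 'I_s]) JA j)%classic.
  by have [_ [JA ?]] := Fsconv _ (valP A); exists JA.
have [J JP] := boolp.choice exJ.
(* Subfamilies without a common point contribute arbitrary extra points, which do no harm; the empty
   one ensures that the list is nonempty. *)
pose common (S : {set F}) : R :=
  xget 0 [set x | forall A : F, A \in S -> (val A) x]%classic.
pose pts : seq R := sort <=%R [seq common U | U : {set F}].
pose pt (i : nat) : R := nth 0 pts i.
have szpts : size pts = (size pts).-1.+1.
  rewrite prednK // size_sort size_map -cardE.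
  by apply/card_gt0P; exists finset.set0.
set n := (size pts).-1 in szpts.
have pt_mono (i k : 'I_n.+1) : (i <= k)%N -> pt i <= pt k.
  move=> ik; apply: (sorted_leq_nth le_trans lexx) => //.
  - by apply: sort_sorted; exact: le_total.
  - by rewrite inE szpts.
  - by rewrite inE szpts.
pose part (A : F) j : pred 'I_n.+1 := fun i => `[< J A j (pt i) >].
have part_convex A j (x y z : 'I_n.+1) :
    (x <= y <= z)%N -> part A j x -> part A j z -> part A j y.
  move=> /andP[xy yz] /asboolP Jx /asboolP Jz; apply/asboolP.
  by apply: ((JP A).1 j _ _ Jx Jz); rewrite !pt_mono.
have hitP A (i : 'I_n.+1) : reflect (val A (pt i)) (hit part A i).
  apply: (iffP existsP) => [[j /asboolP Jj]|].
    by rewrite (JP A).2; exists j.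
  by rewrite (JP A).2 => -[j _ Jj]; exists j; apply/asboolP.
have commonP (S : {set F}) x : (forall A : F, A \in S -> (val A) x) ->
    exists i : 'I_n.+1, forall A, A \in S -> hit part A i.
  move=> Sx.
  have Spts : common S \in pts.
    by rewrite mem_sort; apply/mapP; exists S; rewrite ?mem_enum.
  have iS : (index (common S) pts < n.+1)%N by rewrite -szpts index_mem.
  exists (Ordinal iS) => A AS; apply/hitP; rewrite /pt /= nth_index //.
  by have := @xgetPex _ 0 [set x | forall A : F, A \in S -> (val A) x]%classic
               (ex_intro _ x Sx); apply.
have ne A : exists i, hit part A i.
  have [[x Ax] _] := Fsconv _ (valP A).
  have [i iP] := @commonP [set A]%SET x (fun B => ltac:(by rewrite inE => /eqP ->)).
  by exists i; apply: iP; rewrite inE.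
have loadp (S : {set F}) : #|S| = p -> exists i, (q <= load part S i)%N.
  move=> Sp; pose G := [fset val A | A in S]%fset.
  have [||H [HG Hq [x Hx]]] := pq G.
  - by apply/fsubsetP => _ /imfsetP[A _ ->]; exact: valP.
  - by rewrite card_imfset /=; [rewrite -Sp cardE | exact: val_inj].
  pose S' := [set A in S | val A \in H].
  have [i iP] := @commonP S' x (fun A => ltac:(by rewrite inE => /andP[_ /Hx])).
  exists i; rewrite -Hq.
  have -> : H = [fset val A | A in S']%fset.
    apply/fsetP => B; apply/idP/imfsetP => [BH|[A /=]]; last first.
      by rewrite inE => /andP[_ AH] ->.
    have /imfsetP[A AS BA] := fsubsetP HG _ BH.
    by exists A => //=; rewrite inE -BA BH andbT.
  rewrite card_imfset /=; last exact: val_inj.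
  rewrite -cardE; apply/subset_leq_card/fintype.subsetP => A AS'.
  by rewrite inE iP // andbT; move: AS'; rewrite inE => /andP[].
have pI : (p <= #|{: F}|)%N by rewrite -cardfE.
have [P pP cP] :=
  piercing_bound part_convex s0 qp pI ne loadp Dlarge rlarge qlarge.
apply: (@tau_le _ [fset pt (val i) | i in P]%fset).
  move=> A AF; have [i iP /hitP Ai] := pP [` AF]%fset.
  by exists (pt i) => //; apply/imfsetP; exists i.
by apply: leq_trans cP; apply: leq_trans (leq_imfset_card _ _ _) _; rewrite cardE.
Qed.

(** * Sets of reals: the lower bound *)

Section LowerBound.
Variables (R : realType) (s p q : nat).
Hypotheses (s2 : (2 <= s)%N) (q0 : (0 < q)%N) (qp : (q <= p)%N).

(** There are qs + 1 unit cells, more than q members can delete together. *)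
Let n := (q * s)%N.

(** Cell i is [i, i+1). Nonnegativity is explicit because [Num.truncn] sends negative reals to 0. *)
Definition punctured (S : {set 'I_n.+1}) : set R :=
  [set x | 0 <= x /\ exists2 i : 'I_n.+1, i \notin S & Num.truncn x = i]%classic.

Definition negative_point (j : 'I_(p - q)) : R := - (j.+1)%:R.

Definition small_sets : {set {set 'I_n.+1}} :=
  [set S : {set 'I_n.+1} | (#|S| < s)%N]%SET.

Definition punctured_family : {fset set R} :=
  [fset punctured S | S in small_sets]%fset.

Definition negative_points : {fset set R} :=
  [fset [set negative_point j]%classic | j : 'I_(p - q)]%fset.

Lemma puncturedP (S : {set 'I_n.+1}) (i : 'I_n.+1) :
  punctured S (val i)%:R <-> i \notin S.
Proof.
rewrite /punctured /= natrK; split=> [[_ [k kS /val_inj ->]]|iS] //.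
by split; [exact: ler0n | exists i].
Qed.

Lemma punctured_inj : injective punctured.
Proof.
move=> S U eqSU; apply/setP => i; apply/negb_inj.
by apply/idP/idP => /puncturedP h; apply/puncturedP; [rewrite -eqSU|rewrite eqSU].
Qed.

Lemma negative_point_lt0 j : negative_point j < 0.
Proof. by rewrite oppr_lt0 ltr0n. Qed.

Lemma negative_point_inj : injective negative_point.
Proof. by move=> i j /oppr_inj /eqP; rewrite eqr_nat => /eqP[/val_inj]. Qed.

Lemma punctured_nonempty S : S \in small_sets -> (punctured S !=set0)%classic.
Proof.
rewrite inE => Ss.
have [i iS] : exists i, i \notin S.
  apply/existsP; rewrite -negb_forall; apply/negP => /forallP SI.
  have : #|S| = n.+1 by rewrite -[RHS]card_ord; apply: eq_card => i; rewrite SI.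
  by move: Ss; rewrite /n; nia.
by exists (val i)%:R; apply/puncturedP.
Qed.

(* A point of the punctured set lies in the part indexed by the number of
   punctured cells to its left. *)
Lemma punctured_s_convex S : S \in small_sets -> s_convex s (punctured S).
Proof.
rewrite inE => Ss; pose left_of m := #|[set k in S | (k < m)%N]|.
have mono m m' : (m <= m')%N -> (left_of m <= left_of m')%N.
  move=> mm; apply/subset_leq_card/fintype.subsetP => k; rewrite !inE => /andP[-> km].
  exact: leq_trans mm.
exists (fun j x => punctured S x /\ left_of (Num.truncn x) = j); split; last first.
  apply/seteqP; split=> [x Sx|x [j _ [] //]].
  have lt : (left_of (Num.truncn x) < s)%N.
    apply: leq_ltn_trans Ss; apply/subset_leq_card/fintype.subsetP => k.
    by rewrite inE => /andP[].
  by exists (Ordinal lt).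
move=> j x y [[x0 [i iS xi]] xj] [[y0 [k kS yk]] yj] z /andP[xz zy].
have z0 := le_trans x0 xz.
have xzt : (Num.truncn x <= Num.truncn z)%N by apply: le_truncn.
have zyt : (Num.truncn z <= Num.truncn y)%N by apply: le_truncn.
have ln : (Num.truncn z < n.+1)%N by apply: leq_ltn_trans zyt _; rewrite yk.
have zj : left_of (Num.truncn z) = j.
  by apply/eqP; rewrite eqn_leq -{1}yj -xj !mono.
split=> //; split=> //; exists (Ordinal ln) => //; apply/negP => lS.
have lt : (Num.truncn z < Num.truncn y)%N.
  rewrite ltn_neqAle zyt andbT; apply/eqP => zyE.
  by move: kS; rewrite (_ : k = Ordinal ln) ?lS //; apply: val_inj; rewrite /= zyE.
have : (left_of (Num.truncn z) < left_of (Num.truncn y))%N.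
  apply: proper_card; apply/properP; split.
    apply/fintype.subsetP => m; rewrite !inE => /andP[-> mz]; exact: ltn_trans lt.
  by exists (Ordinal ln); rewrite inE lS /= ?lt ?ltnn.
by rewrite zj yj ltnn.
Qed.

Let F : {fset set R} := (punctured_family `|` negative_points)%fset.

Lemma family_s_convex A : A \in F -> (A !=set0)%classic /\ s_convex s A.
Proof.
rewrite in_fsetU => /orP[/imfsetP[S /= Ssmall ->]|/imfsetP[j _ ->]].
  by split; [exact: punctured_nonempty | exact: punctured_s_convex].
split; first by exists (negative_point j).
exists (fun=> [set negative_point j]%classic); split.
  move=> _ x y -> -> z /= /andP[? ?]; apply/eqP; by rewrite eq_le; apply/andP.
apply/seteqP; split=> x; last by case.
by move=> xj; exists (Ordinal (ltnW s2)).
Qed.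

(** Deleting a single cell is allowed as s >= 2, and gives n + 1 members already. *)
Lemma card_punctured_family : (q <= #|` punctured_family|)%N.
Proof.
rewrite card_imfset /=; last exact: punctured_inj.
rewrite -cardE; apply: leq_trans (_ : #|[set [set i] | i : 'I_n.+1]%SET| <= _)%N.
  rewrite card_imset; last exact: set1_inj.
  by rewrite card_ord /n; nia.
by apply/subset_leq_card/fintype.subsetP => _ /imsetP[i _ ->]; rewrite inE cards1.
Qed.

Lemma card_negative_points : #|` negative_points| = (p - q)%N.
Proof.
rewrite card_imfset /=; first by rewrite -cardE card_ord.
move=> i j ij; apply: negative_point_inj.
by have : [set negative_point j]%classic (negative_point i) by rewrite -ij.
Qed.

Lemma card_family : (p <= #|` F|)%N.
Proof.
rewrite cardfsU (_ : (_ `&` _)%fset = fset0); last first.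
  apply/fsetP => A; rewrite in_fsetI in_fset0; apply/negP => /andP[].
  move=> /imfsetP[S _ ->] /imfsetP[j _ /seteqP[_ /(_ (negative_point j) erefl)]].
  by case; rewrite leNgt negative_point_lt0.
rewrite cardfs0 subn0 card_negative_points.
by apply: leq_trans (leq_add card_punctured_family (leqnn _)); rewrite subnKC.
Qed.

Lemma common_point (H : {fset set R}) :
  (H `<=` punctured_family)%fset -> #|` H| = q ->
  exists x, forall A, A \in H -> A x.
Proof.
move=> HF Hq; pose miss (A : set R) := [set i : 'I_n.+1 | ~~ `[< A (val i)%:R >]].
pose U := (\bigcup_(A <- H) miss A)%SET.
have cU (hs : seq (set R)) :
    (#|(\bigcup_(A <- hs) miss A)%SET| <= \sum_(A <- hs) #|miss A|)%N.
  elim: hs => [|A hs IH]; first by rewrite !big_nil cards0.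
  by rewrite !big_cons; apply: leq_trans (leq_card_setU _ _) _; rewrite leq_add2l.
have Un : (#|U| < n.+1)%N.
  rewrite ltnS; apply: leq_trans (cU _) _.
  apply: (@leq_trans (\sum_(A <- H) s)%N); last first.
    by rewrite big_const_seq count_predT iter_addn addn0 /n mulnC -Hq.
  rewrite big_seq [leqRHS]big_seq; apply: leq_sum => A /(fsubsetP HF).
  move=> /imfsetP[S /=]; rewrite inE => /ltnW Ss ->; apply: leq_trans Ss.
  apply/subset_leq_card/fintype.subsetP => i; rewrite inE.
  by apply: contraNT => iS; apply/asboolP/puncturedP.
have [i iU] : exists i, i \notin U.
  apply/existsP; rewrite -negb_forall; apply/negP => /forallP UI.
  by move: Un; rewrite (_ : #|U| = n.+1) ?ltnn // -[RHS]card_ord;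
    apply: eq_card => i; rewrite UI.
exists (val i)%:R => A AH; apply: contrapT => nA.
move/negP: iU; apply; rewrite /U (big_rem A) //= inE; apply/orP; left.
by rewrite inE; apply/asboolPn.
Qed.

(** At most p - q of any p members are isolated points; the q others leave one of the n + 1 cells
    undeleted by all. *)
Lemma family_pq : pq_property p q F.
Proof.
split=> [|G GF Gp]; first exact: card_family.
pose GA := (G `&` punctured_family)%fset.
have GAq : (q <= #|` GA|)%N.
  have le : (#|` (G `\` punctured_family)%fset| <= p - q)%N.
    rewrite -card_negative_points; apply: fsubset_leq_card.
    by rewrite fsubDset.
  by have := cardfsID punctured_family G; rewrite -/GA Gp; lia.
pose H := [fset A in take q (enum_fset GA)]%fset.
have HGA : (H `<=` GA)%fset by apply/fsubsetP => _ /imfsetP[A /= /mem_take AG ->].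
have cH : #|` H| = q.
  by rewrite card_fseq undup_id ?take_uniq // size_takel.
exists H; split=> //; first by apply: fsubset_trans HGA _; exact: fsubsetIl.
by apply: common_point => //; apply: fsubset_trans HGA _; exact: fsubsetIr.
Qed.

(** Every isolated point is forced. Were there fewer than s further points, the member deleting
    exactly their cells would be missed. *)
Lemma tau_family : (p - q + s <= tau F)%N.
Proof.
have [P0 P0t] := @transversal_exists R F (fun A AF => (family_s_convex AF).1).
have ex : exists m, exists2 P : {fset R}, Defs.transversal P F & #|` P| = m.
  by exists #|` P0|, P0.
have [[P Pt cP] _] := leastP ex; rewrite /tau -cP.
pose N := [fset negative_point j | j : 'I_(p - q)]%fset.
have cN : #|` N| = (p - q)%N.
  rewrite card_imfset /=; first by rewrite -cardE card_ord.
  exact: negative_point_inj.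
have NP : (N `<=` P)%fset.
  apply/fsubsetP => _ /imfsetP[j _ ->].
  have [|x xP /= <-] // := Pt [set negative_point j]%classic.
  by rewrite in_fsetU; apply/orP; right; apply/imfsetP; exists j.
rewrite leqNgt; apply/negP => small.
have cPN : (#|` (P `\` N)%fset| < s)%N by rewrite cardfsDS // cN; lia.
(* Points outside the cells are sent to cell 0, which at worst deletes that cell too; the count
   stays below s. *)
pose S := [set i in [seq inord (Num.truncn x) : 'I_n.+1 | x <- (P `\` N)%fset]].
have Ssmall : S \in small_sets.
  rewrite inE cardsE; apply: leq_ltn_trans (card_size _) _.
  by rewrite size_map.
have [|x xP [x0 [i iS xi]]] := Pt (punctured S).
  by rewrite in_fsetU; apply/orP; left; apply/imfsetP; exists S.
move/negP: iS; apply; rewrite inE; apply/mapP; exists x; last first.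
  by rewrite xi; apply/val_inj; rewrite /= inordK.
rewrite in_fsetD xP andbT; apply/negP => /imfsetP[j _ xj].
by move: x0; rewrite xj leNgt negative_point_lt0.
Qed.

Lemma HD_bound_lower N : HD_bound R s p q N -> (p - q + s <= N)%N.
Proof.
move=> bnd; apply: leq_trans tau_family _.
by apply: bnd; [exact: family_s_convex | exact: family_pq].
Qed.

End LowerBound.

Theorem theorem1p6 (R : realType) :
  exists C0 : R, 0 < C0 /\
    forall p q s : nat, (2 <= q)%N -> (q <= p)%N -> (2 <= s)%N ->
      C0 * s%:R * ln (2 * s%:R) * ln (expR 1 * p%:R) <= q%:R ->
      (p - q + s <= HD R s p q)%N /\ (HD R s p q <= p - q + 2 * s + 1)%N.
Proof.
exists 200; split=> // p q s q2 qp s2 qlarge.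
have [D [r [Dlarge rlarge Dr]]] := parameters q2 qp s2 qlarge.
have upper := HD_bound_upper (ltnW s2) qp Dlarge rlarge Dr.
have [HD_bounds HD_min] := leastP (ex_intro _ _ upper).
split; first exact: HD_bound_lower s2 (ltnW q2) qp _ HD_bounds.
(* The bound obtained, p - q + 2s, is one better than claimed. *)
by rewrite addn1 ltnW // ltnS; exact: HD_min.
Qed.
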